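(* Let $G$ be a Lie group endowed with a right-invariant Riemannian metric, let $g$ be the barycentric metric on the tangent pseudo-bundle $TE^{\mathrm{sph}}(G)$, let $\mathcal K\subset TE^{\mathrm{sph}}(G)$ be the pseudo-bundle with fibers $\mathcal K_p=\ker g_p$, and let $\mathcal H:=TE^{\mathrm{sph}}(G)/\mathcal K$ be the quotient pseudo-bundle. Then $g$ induces a (fiberwise) non-degenerate bilinear form $$\bar g:\mathcal H\times\mathcal H\longrightarrow\mathbb R .$$
   Context: Spherical Milnor space: $E^{\mathrm{sph}}(G)$ is the set of families $(x_i,g_i)_{i\in\mathbb N}$ with $x_i\in\mathbb R$ finitely supported, $\sum_i x_i^2=1$, $g_i\in G$, modulo $(x_i,g_i)\sim(x_i,g_i')$ iff $g_i=g_i'$ whenever $x_i\ne0$. Its finite local models are $S_I\times G^I$ ($I\subset\mathbb N$ finite, $S_I$ the unit sphere of $\mathbb R^I$), and $TE^{\mathrm{sph}}(G)$ is described locally as the colimit of the $T(S_I\times G^I)$: a tangent vector at $p=[(x_i,g_i)]$ is a pair $(v,\xi)$ with $v=(v_i)$ a finitely supported real sequence, $\sum_i x_iv_i=0$, and $\xi=(\xi_i)$ a finitely supported family with $\xi_i\in T_{g_i}G$. The barycentric metric is the symmetric bilinear form associated with the quadratic form $g_p(v,\xi)=\sum_i v_i^2+\sum_i x_i^2\|\xi_i\|_G^2$, and $\ker g_p=\{w: g_p(w,w')=0\ \text{for all tangent vectors } w' \text{ at } p\}$. Here products $\mathcal H\times\mathcal H$ are fiber products over $E^{\mathrm{sph}}(G)$,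 and non-degenerate means that $\bar g_p(a,b)=0$ for all $b\in\mathcal H_p$ implies $a=0$. *)

(* Defs.v *)
From HB Require Import structures.
From mathcomp Require Import all_boot all_order all_algebra.
From mathcomp Require Import all_classical all_reals all_analysis.
From mathcomp Require Import finmap ring.

Set Implicit Arguments.
Unset Strict Implicit.
Unset Printing Implicit Defensive.

Import Order.TTheory GRing.Theory Num.Theory.
Import numFieldNormedType.Exports.

Local Open Scope classical_set_scope.
Local Open Scope quotient_scope.
Local Open Scope ring_scope.

(* [Ck k U f] is only meant for open [U].  In finite dimension, having
   iterated directional derivatives up to order [k], all continuous on [U], is
   the same as being of class C^k on [U]. *)
Fixpoint Ck (R : realType) (V W : normedModType R) (k : nat) (U : set V)
    (f : V -> W) : Prop :=
  (forall x, U x -> {for x, continuous f}) /\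
  if k is k'.+1 then
    forall v : V, (forall x, U x -> derivable f x v) /\ Ck k' U ('D_v f)
  else True.

Definition smooth_on (R : realType) (V W : normedModType R) (U : set V)
    (f : V -> W) : Prop := forall k, Ck k U f.

(* [chart_map] is meaningful on [chart_dom] only, and [chart_inv] on
   [chart_cod] only; see [is_chart]. *)
Record chart (R : realType) (V : normedModType R) (M : Type) := Chart {
  chart_dom : set M;
  chart_map : M -> V;
  chart_inv : V -> M
}.

Definition chart_cod (R : realType) (V : normedModType R) (M : Type)
  (c : chart V M) : set V := chart_map c @` chart_dom c.

Definition is_chart (R : realType) (V : normedModType R) (M : topologicalType)
    (c : chart V M) : Prop :=
  [/\ open (chart_dom c), open (chart_cod c),
      forall a, chart_dom c a -> chart_inv c (chart_map c a) = a,
      {within chart_dom c, continuous (chart_map c)} &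
      {within chart_cod c, continuous (chart_inv c)}].

Definition smooth_atlas (R : realType) (V : normedModType R)
    (M : topologicalType) (A : set (chart V M)) : Prop :=
  [/\ forall c, A c -> is_chart c,
      \bigcup_(c in A) chart_dom c = setT &
      forall c d, A c -> A d ->
        smooth_on (chart_map c @` (chart_dom c `&` chart_dom d))
                  (chart_map d \o chart_inv c)].

Definition smooth_map (R : realType) (V W : normedModType R)
    (M N : topologicalType) (A : set (chart V M)) (B : set (chart W N))
    (F : M -> N) : Prop :=
  continuous F /\
  forall c d, A c -> B d ->
    smooth_on (chart_map c @` (chart_dom c `&` F @^-1` chart_dom d))
              (chart_map d \o F \o chart_inv c).

Definition smooth_fun (R : realType) (V : normedModType R) (M : Type)
    (A : set (chart V M)) (f : M -> R) : Prop :=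
  forall c, A c -> smooth_on (chart_cod c) (f \o chart_inv c : V -> R^o).

Definition prod_chart (R : realType) (V W : normedModType R) (M N : Type)
    (c : chart V M) (d : chart W N) : chart (V * W)%type (M * N) :=
  {| chart_dom := chart_dom c `*` chart_dom d;
     chart_map := fun p => (chart_map c p.1, chart_map d p.2);
     chart_inv := fun z => (chart_inv c z.1, chart_inv d z.2) |}.

Definition prod_atlas (R : realType) (V W : normedModType R) (M N : Type)
    (A : set (chart V M)) (B : set (chart W N)) :
    set (chart (V * W)%type (M * N)) :=
  [set e | exists c d, [/\ A c, B d & e = prod_chart c d]].

HB.mixin Record isLieGroup (R : realType) (n : nat) G
    of Topological G & Group G := {
  lie_atlas : set (chart 'rV[R]_n G);
  lie_hausdorff : hausdorff_space G;
  lie_second_countable : @second_countable G;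
  lie_atlasP : smooth_atlas lie_atlas;
  lie_mul_smooth : smooth_map (prod_atlas lie_atlas lie_atlas) lie_atlas
                     (fun p : G * G => (p.1 * p.2)%g);
  lie_inv_smooth : smooth_map lie_atlas lie_atlas (fun a : G => (a^-1)%g)
}.

#[short(type="lieGroupType")]
HB.structure Definition LieGroup (R : realType) (n : nat) :=
  {G of isLieGroup R n G & Topological G & Group G}.

Definition smooth (R : realType) (n : nat) (G : lieGroupType R n)
  (f : G -> R) : Prop := smooth_fun (lie_atlas (R := R) (n := n)) f.

Section Tangent.
Variables (R : realType) (n : nat) (G : lieGroupType R n).

(* A derivation is a function on C^oo(G); it is encoded as a function on all
   of [G -> R] by giving it the value 0 outside C^oo(G). *)
Definition is_derivation (a : G) (D : (G -> R) -> R) : Prop :=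
  [/\ forall f, ~ smooth f -> D f = 0,
      forall f g, smooth f -> smooth g -> D (f \+ g) = D f + D g,
      forall k f, smooth f -> D (k \*o f) = k * D f &
      forall f g, smooth f -> smooth g -> D (f \* g) = f a * D g + D f * g a].

Definition derivation (a : G) : {pred (G -> R) -> R} :=
  fun D => `[< is_derivation a D >].

Lemma derivation_submod_closed a : submod_closed (derivation a).
Proof.
split=> [|k D E].
  rewrite unfold_in; apply/asboolP.
  by split=> *; rewrite /= ?(addr0, mulr0, mul0r).
rewrite !unfold_in => /asboolP[D0 DD DZ DM] /asboolP[E0 ED EZ EM].
apply/asboolP; split.
- by move=> f nf; rewrite /= !fctE D0// E0// scaler0 addr0.
- by move=> f g sf sg; rewrite !fctE DD// ED// scalerDr addrACA.
- move=> c f sf; rewrite !fctE DZ// EZ// mulrDr; congr (_ + _).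
  exact: mulrCA.
- move=> f g sf sg; rewrite !fctE DM// EM// /GRing.scale/=; ring.
Qed.

HB.instance Definition _ a := GRing.isSubmodClosed.Build R ((G -> R) -> R)
  (derivation a) (derivation_submod_closed a).

Definition tangent (a : G) := {D : (G -> R) -> R | D \in derivation a}.

HB.instance Definition _ a := SubChoice.on (tangent a).
HB.instance Definition _ a :=
  [SubChoice_isSubLmodule of tangent a by <:].

(* [u'] is the image of [u] under the differential of [F] at [a]. *)
Definition is_pushforward (F : G -> G) (a : G) (u : tangent a)
    (u' : tangent (F a)) : Prop :=
  forall f, smooth f -> \val u' f = \val u (f \o F).

Definition smooth_vector_field (X : forall a : G, tangent a) : Prop :=
  forall f, smooth f -> smooth (fun a => \val (X a) f).

Record riemannian_metric := RiemannianMetric {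
  rmetric :> forall a : G, {biscalar (tangent a)};
  rmetric_sym : forall a u v, rmetric a u v = rmetric a v u;
  rmetric_gt0 : forall a (u : tangent a), u != 0 -> 0 < rmetric a u u;
  rmetric_smooth : forall X Y,
    smooth_vector_field X -> smooth_vector_field Y ->
    smooth (fun a => rmetric a (X a) (Y a))
}.

Definition right_invariant (m : riemannian_metric) : Prop :=
  forall (h a : G) (u v : tangent a) (u' v' : tangent (a * h)%g),
    is_pushforward (F := fun b => (b * h)%g) u u' ->
    is_pushforward (F := fun b => (b * h)%g) v v' ->
    m (a * h)%g u' v' = m a u v.

End Tangent.

Definition family (R : pzRingType) (I : Type) (V : I -> lmodType R) : Type :=
  forall i, V i.

Section Family.
Variables (R : pzRingType) (I : Type) (V : I -> lmodType R).
Implicit Types u v w : family V.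

HB.instance Definition _ := gen_eqMixin (family V).
HB.instance Definition _ := gen_choiceMixin (family V).

Let fadd u v : family V := fun i => u i + v i.
Let fopp u : family V := fun i => - u i.
Let fzero : family V := fun=> 0.
Let fscale (k : R) u : family V := fun i => k *: u i.

Let faddA : associative fadd.
Proof. by move=> u v w; apply: functional_extensionality_dep => i; apply: addrA. Qed.
Let faddC : commutative fadd.
Proof. by move=> u v; apply: functional_extensionality_dep => i; apply: addrC. Qed.
Let fadd0 : left_id fzero fadd.
Proof. by move=> u; apply: functional_extensionality_dep => i; apply: add0r. Qed.
Let faddN : left_inverse fzero fopp fadd.
Proof. by move=> u; apply: functional_extensionality_dep => i; apply: addNr. Qed.

HB.instance Definition _ :=
  GRing.isZmodule.Build (family V) faddA faddC fadd0 faddN.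

Let fscaleA k l u : fscale k (fscale l u) = fscale (k * l) u.
Proof. by apply: functional_extensionality_dep => i; apply: scalerA. Qed.
Let fscale1 : left_id 1 fscale.
Proof. by move=> u; apply: functional_extensionality_dep => i; apply: scale1r. Qed.
Let fscaleDr : right_distributive fscale +%R.
Proof. by move=> k u v; apply: functional_extensionality_dep => i; apply: scalerDr. Qed.
Let fscaleDl u : {morph fscale^~ u : k l / k + l}.
Proof. by move=> k l; apply: functional_extensionality_dep => i; apply: scalerDl. Qed.

HB.instance Definition _ := GRing.Zmodule_isLmodule.Build R (family V)
  fscaleA fscale1 fscaleDr fscaleDl.

Lemma familyD u v i : (u + v) i = u i + v i. Proof. by []. Qed.
Lemma familyZ k u i : (k *: u) i = k *: u i. Proof. by []. Qed.
Lemma family0 i : (0 : family V) i = 0. Proof. by []. Qed.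

End Family.

Section QuotLmod.
Variables (R : pzRingType) (V : lmodType R) (K : submodClosed V).

Definition quot_lmod_eq (u v : V) : bool := u - v \in K.

Lemma quot_lmod_eq_equiv : equiv_class_of quot_lmod_eq.
Proof.
have symK u v : quot_lmod_eq u v -> quot_lmod_eq v u.
  by rewrite /quot_lmod_eq => /(rpredZ (-1)); rewrite scaleN1r opprB.
split=> [u|u v|v u w]; first by rewrite /quot_lmod_eq subrr rpred0.
  by apply/idP/idP; exact: symK.
by move=> uv /(rpredD uv); rewrite addrA subrK.
Qed.

Canonical quot_lmod_rel := EquivRelPack quot_lmod_eq_equiv.
Canonical quot_lmod_encModRel := defaultEncModRel quot_lmod_eq.

Definition quot_lmod := {eq_quot quot_lmod_eq}.

HB.instance Definition _ : EqQuotient V quot_lmod_eq quot_lmod :=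
  EqQuotient.on quot_lmod.
HB.instance Definition _ := Choice.on quot_lmod.

Local Notation Q := quot_lmod.
Implicit Types (a b c : Q) (u v : V) (k l : R).

Lemma eq_quot_lmod u v : (\pi_Q u == \pi_Q v) = (u - v \in K).
Proof. exact: eqquotE. Qed.

Let qW (P : Q -> Prop) : (forall u, P (\pi_Q u)) -> forall a, P a.
Proof. by move=> Pu a; rewrite -[a]reprK. Qed.

Let reprB u : repr (\pi_Q u) - u \in K.
Proof. by rewrite -eq_quot_lmod reprK. Qed.

Let qadd a b : Q := \pi_Q (repr a + repr b).
Let qopp a : Q := \pi_Q (- repr a).
Let qscale k a : Q := \pi_Q (k *: repr a).

Let pi_qadd u v : qadd (\pi_Q u) (\pi_Q v) = \pi_Q (u + v).
Proof. by apply/eqP; rewrite eq_quot_lmod opprD addrACA rpredD. Qed.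
Let pi_qopp u : qopp (\pi_Q u) = \pi_Q (- u).
Proof.
by apply/eqP; rewrite eq_quot_lmod -opprD -[X in X \in _]scaleN1r rpredZ.
Qed.
Let pi_qscale k u : qscale k (\pi_Q u) = \pi_Q (k *: u).
Proof. by apply/eqP; rewrite eq_quot_lmod -scalerBr rpredZ. Qed.

Let qaddA : associative qadd.
Proof.
move=> a b c.
elim/qW: a => u; elim/qW: b => v; elim/qW: c => w.
by rewrite !pi_qadd addrA.
Qed.
Let qaddC : commutative qadd.
Proof. by move=> a b; elim/qW: a => u; elim/qW: b => v; rewrite !pi_qadd addrC. Qed.
Let qadd0 : left_id (\pi_Q 0) qadd.
Proof. by move=> a; elim/qW: a => u; rewrite pi_qadd add0r. Qed.
Let qaddN : left_inverse (\pi_Q 0) qopp qadd.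
Proof. by move=> a; elim/qW: a => u; rewrite pi_qopp pi_qadd addNr. Qed.

HB.instance Definition _ := GRing.isZmodule.Build Q qaddA qaddC qadd0 qaddN.

Let qscaleA k l a : qscale k (qscale l a) = qscale (k * l) a.
Proof. by elim/qW: a => u; rewrite !pi_qscale scalerA. Qed.
Let qscale1 : left_id 1 qscale.
Proof. by move=> a; elim/qW: a => u; rewrite pi_qscale scale1r. Qed.
Let qscaleDr : right_distributive qscale +%R.
Proof.
move=> k a b; elim/qW: a => u; elim/qW: b => v.
rewrite 2!pi_qscale [RHS]pi_qadd -scalerDr -pi_qscale; congr (qscale k _).
exact: pi_qadd.
Qed.
Let qscaleDl a : {morph qscale^~ a : k l / k + l}.
Proof.
by move=> k l; elim/qW: a => u; rewrite !pi_qscale [RHS]pi_qadd -scalerDl.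
Qed.

HB.instance Definition _ := GRing.Zmodule_isLmodule.Build R Q
  qscaleA qscale1 qscaleDr qscaleDl.

Lemma pi_quot_lmodD u v : \pi_Q (u + v) = \pi_Q u + \pi_Q v.
Proof. by rewrite [RHS]pi_qadd. Qed.
Lemma pi_quot_lmodZ k u : \pi_Q (k *: u) = k *: \pi_Q u.
Proof. by rewrite [RHS]pi_qscale. Qed.

End QuotLmod.

Section Milnor.
Variables (R : realType) (n : nat) (G : lieGroupType R n).

Record preEsph := PreEsph {
  sph_x : nat -> R;
  sph_g : nat -> G;
  sph_finite : finite_set [set i | sph_x i != 0];
  sph_norm : \sum_(i \in [set: nat]) sph_x i ^+ 2 = 1
}.

HB.instance Definition _ := gen_eqMixin preEsph.
HB.instance Definition _ := gen_choiceMixin preEsph.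

Definition sph_eq (p q : preEsph) : bool :=
  `[< sph_x p = sph_x q /\
      forall i, sph_x p i != 0 -> sph_g p i = sph_g q i >].

Lemma sph_eq_equiv : equiv_class_of sph_eq.
Proof.
split=> [p|p q|q p r]; first exact/asboolP.
  by apply/asboolP/asboolP => -[e h]; split=> // i xi; rewrite h// ?e// -e.
move=> /asboolP[e h] /asboolP[e' h']; apply/asboolP; split; first by rewrite e.
by move=> i xi; rewrite h// h'// -e.
Qed.

Canonical sph_eq_rel := EquivRelPack sph_eq_equiv.
Canonical sph_eq_encModRel := defaultEncModRel sph_eq.

Definition Esph := {eq_quot sph_eq}.

HB.instance Definition _ : EqQuotient preEsph sph_eq Esph := EqQuotient.on Esph.

(* When [sph_x q i = 0], the class of [q] does not determine [sph_g q i], so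
   the space [T_(g_i) G] in which [xi_i] lives depends on the representative.
   Tangent vectors at a point of [Esph] are therefore given in a
   representative [q]; the bundles over [Esph] have as fibre at [p] the spaces
   below at [s p], for a choice [s : Esph -> preEsph] of representatives. *)
Definition is_sph_tangent (q : preEsph) :
    {pred (nat -> R) * family (fun i => tangent (sph_g q i))} :=
  fun w => `[< [/\ finite_set [set i | w.1 i != 0],
                   finite_set [set i | w.2 i != 0] &
                   \sum_(i \in [set: nat]) sph_x q i * w.1 i = 0] >].
Arguments is_sph_tangent : clear implicits.

Lemma finite_supp_common (q : preEsph) (P Q : set nat) :
  finite_set P -> finite_set Q ->
  exists A : {fset nat}, forall i, i \notin A ->
    [/\ sph_x q i = 0, ~ P i & ~ Q i].
Proof.
move=> fP fQ; exists (fset_set ([set i | sph_x q i != 0] `|` P `|` Q)) => i.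
have fin : finite_set ([set i | sph_x q i != 0] `|` P `|` Q).
  by rewrite !finite_setU; split=> //; split=> //; exact: sph_finite.
rewrite in_fset_set// notin_setE => /not_orP[/not_orP[x0 nP] nQ].
by split=> //; apply/eqP; apply: contra_notT x0.
Qed.

Lemma sph_tangent_submod_closed q : submod_closed (is_sph_tangent q).
Proof.
split.
  rewrite unfold_in; apply/asboolP; split.
  - by apply: sub_finite_set (@finite_set0 nat) => i /=; rewrite eqxx.
  - by apply: sub_finite_set (@finite_set0 nat) => i /=; rewrite eqxx.
  - by apply: fsbig1 => i _ /=; rewrite mulr0.
move=> k u v; rewrite !unfold_in => /asboolP[u1 u2 ux] /asboolP[v1 v2 vx].
have fU (T U : set nat) : finite_set T -> finite_set U -> finite_set (T `|` U).
  by move=> fT fU; rewrite finite_setU.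
apply/asboolP; split.
- apply: sub_finite_set (fU _ _ u1 v1) => i /= h.
  apply: contrapT => /not_orP[/negP/negPn/eqP ui /negP/negPn/eqP vi].
  by move: h; rewrite [X in X != _](_ : _ = k * u.1 i + v.1 i)// ui vi mulr0 addr0 eqxx.
- apply: sub_finite_set (fU _ _ u2 v2) => i /= h.
  apply: contrapT => /not_orP[/negP/negPn/eqP ui /negP/negPn/eqP vi].
  by move: h; rewrite [X in X != _](_ : _ = k *: u.2 i + v.2 i)// ui vi scaler0 addr0 eqxx.
- have [A HA] := finite_supp_common q u1 v1.
  have out w i : i \notin A -> sph_x q i * w = 0.
    by move=> /HA[-> _ _]; rewrite mul0r.
  rewrite (fsbigTE A) in ux; last by move=> i; exact: out.
  rewrite (fsbigTE A) in vx; last by move=> i; exact: out.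
  rewrite (fsbigTE A); last by move=> i; exact: out.
  rewrite (eq_bigr (fun i =>
    k * (sph_x q i * u.1 i) + sph_x q i * v.1 i)) => [|i _].
    by rewrite big_split/= -mulr_sumr ux vx mulr0 addr0.
  rewrite [X in _ * X](_ : _ = k * u.1 i + v.1 i)//; ring.
Qed.

HB.instance Definition _ q := GRing.isSubmodClosed.Build R _
  (is_sph_tangent q) (sph_tangent_submod_closed q).

Definition sph_tangent (q : preEsph) :=
  {w : (nat -> R) * family (fun i => tangent (sph_g q i)) |
     w \in is_sph_tangent q}.

HB.instance Definition _ q := SubChoice.on (sph_tangent q).
HB.instance Definition _ q :=
  [SubChoice_isSubLmodule of sph_tangent q by <:].

Variable m : riemannian_metric G.

Definition bary_quad (q : preEsph) (w : sph_tangent q) : R :=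
  \sum_(i \in [set: nat]) (\val w).1 i ^+ 2 +
  \sum_(i \in [set: nat]) sph_x q i ^+ 2 *
     m (sph_g q i) ((\val w).2 i) ((\val w).2 i).

(* The symmetric bilinear form of [bary_quad], by polarization. *)
Definition bary (q : preEsph) (w w' : sph_tangent q) : R :=
  2^-1 * (bary_quad (w + w') - bary_quad w - bary_quad w').

Lemma baryE q (w w' : sph_tangent q) :
  bary w w' =
    \sum_(i \in [set: nat]) (\val w).1 i * (\val w').1 i +
    \sum_(i \in [set: nat]) sph_x q i ^+ 2 *
       m (sph_g q i) ((\val w).2 i) ((\val w').2 i).
Proof.
have /asboolP[w1 _ _] := valP w; have /asboolP[w'1 _ _] := valP w'.
have [A HA] := finite_supp_common q w1 w'1.
have HA1 i : i \notin A -> (\val w).1 i = 0 /\ (\val w').1 i = 0.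
  by move=> /HA[_ /negP/negPn/eqP-> /negP/negPn/eqP->].
have HA0 i c : i \notin A -> sph_x q i ^+ 2 * c = 0.
  by move=> /HA[-> _ _]; rewrite expr0n mul0r.
rewrite /bary /bary_quad.
rewrite !(fsbigTE A); do ?[by move=> i /HA0
  | by move=> i /HA1[e e']; rewrite ?GRing.valD/= ?fctE ?e ?e' ?addr0 ?mulr0 ?expr0n].
rewrite -!big_split/= -!sumrB mulr_sumr; apply: eq_bigr => i _.
have mDr u v z : m (sph_g q i) u (v + z) = m _ u v + m _ u z.
  exact: linearDr.
rewrite /= fctE familyD linearDl/= !mDr.
rewrite (rmetric_sym m ((\val w').2 i) ((\val w).2 i)).
by field.
Qed.

Lemma bary_sym q (w w' : sph_tangent q) : bary w w' = bary w' w.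
Proof. by rewrite /bary [w + w']addrC [in LHS]addrAC. Qed.

Lemma bary_linearl q (w' : sph_tangent q) : scalar (fun w => bary w w').
Proof.
move=> k u v; rewrite !baryE.
have /asboolP[w'1 _ _] := valP w'.
have [A HA] := finite_supp_common q w'1 w'1.
have HA1 i c : i \notin A -> c * (\val w').1 i = 0.
  by move=> /HA[_ /negP/negPn/eqP-> _]; rewrite mulr0.
have HA0 i c : i \notin A -> sph_x q i ^+ 2 * c = 0.
  by move=> /HA[-> _ _]; rewrite expr0n mul0r.
rewrite !(fsbigTE A); do ?[by move=> i /HA0 | by move=> i /HA1].
rewrite -!big_split/= mulr_sumr -big_split/=; apply: eq_bigr => i _.
have mDl a b z : m (sph_g q i) (k *: a + b) z = k * m _ a z + m _ b z.
  exact: linearPl.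
rewrite [X in X * _](_ : _ = k * (\val u).1 i + (\val v).1 i)//.
by rewrite familyD familyZ mDl; ring.
Qed.

Lemma bary_linearr q (w : sph_tangent q) : scalar (bary w).
Proof. by move=> k u v; rewrite !(bary_sym w); exact: bary_linearl. Qed.

HB.instance Definition _ q := @bilinear_isBilinear.Build R
  (sph_tangent q) (sph_tangent q) R *%R *%R (@bary q)
  (@bary_linearl q, @bary_linearr q).

Definition bary_ker (q : preEsph) : {pred sph_tangent q} :=
  fun w => `[< forall w' : sph_tangent q, bary w w' = 0 >].
Arguments bary_ker : clear implicits.

Lemma bary_ker_submod_closed q : submod_closed (bary_ker q).
Proof.
split=> [|k u v].
  by rewrite unfold_in; apply/asboolP => w'; exact: linear0l.
rewrite !unfold_in => /asboolP u0 /asboolP v0; apply/asboolP => w'.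
by rewrite bary_linearl u0 v0 mulr0 addr0.
Qed.

HB.instance Definition _ q := GRing.isSubmodClosed.Build R (sph_tangent q)
  (bary_ker q) (bary_ker_submod_closed q).

Definition sph_quot (q : preEsph) := quot_lmod (bary_ker q).

End Milnor.

Arguments is_sph_tangent {R n G} q w.
Arguments bary_ker {R n G} m q w.

(* Main.v *)
Require Import Defs.
From HB Require Import structures.
From mathcomp Require Import all_boot all_order all_algebra.
From mathcomp Require Import all_classical all_reals all_analysis.

(** A bilinear form is well defined on the quotient by a subspace contained in
    its kernel on either side; dividing by the whole kernel leaves a
    non-degenerate form, because a class orthogonal to every class is
    represented by a vector orthogonal to every vector, that is, by an element
    of the kernel.  [bilinear_form_descends] and [descended_form_nondegenerate]
    carry these two facts over an arbitrary module.  The barycentric form is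
    symmetric, so that its left kernel, by which the tangent space is divided,
    is also its right kernel; applying the two lemmas in each fibre proves the
    theorem. *)

Local Open Scope quotient_scope.
Local Open Scope ring_scope.

Import GRing.Theory.

(** Two representatives of a class differ by an element of [K], on which [f]
    vanishes; hence evaluating [f] at arbitrary representatives is well
    defined, and it inherits linearity from [f]. *)
Lemma bilinear_form_descends (R : comNzRingType) (V : lmodType R)
    (K : submodClosed V) (f : {biscalar V}) :
    (forall u v, u \in K -> f u v = 0) -> (forall u v, v \in K -> f u v = 0) ->
  exists fbar : {biscalar (quot_lmod K)},
    forall u v, fbar (\pi_(quot_lmod K) u) (\pi_(quot_lmod K) v) = f u v.
Proof.
move=> fKl fKr; pose Q := quot_lmod K.
pose g (a b : Q) : R := f (repr a) (repr b).
have gE u v : g (\pi_Q u) (\pi_Q v) = f u v.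
  have reprB w : repr (\pi_Q w) - w \in K by rewrite -eq_quot_lmod reprK.
  rewrite /g -[repr (\pi_Q u)](subrK u) linearDl/= fKl// add0r.
  by rewrite -[repr (\pi_Q v)](subrK v) linearDr/= fKr// add0r.
have g_linearl b : scalar (g^~ b).
  move=> k a c; rewrite -[a]reprK -[b]reprK -[c]reprK /=.
  by rewrite -pi_quot_lmodZ -pi_quot_lmodD !gE linearPl.
have g_linearr a : scalar (g a).
  move=> k b c; rewrite -[a]reprK -[b]reprK -[c]reprK /=.
  by rewrite -pi_quot_lmodZ -pi_quot_lmodD !gE linearPr.
pose gB := @bilinear_isBilinear.Build R Q Q R *%R *%R g (g_linearl, g_linearr).
pose gbar : {biscalar Q} := HB.pack g gB.
by exists gbar.
Qed.

(** Every vector represents some class, so a class orthogonal to all classes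
    has a representative orthogonal to all vectors.  That [K] contains the whole
    left kernel of [f] is what makes this representative trivial in the
    quotient. *)
Lemma descended_form_nondegenerate (R : comNzRingType) (V : lmodType R)
    (K : submodClosed V) (f : V -> V -> R)
    (fbar : quot_lmod K -> quot_lmod K -> R) :
    (forall u, (forall v, f u v = 0) -> u \in K) ->
    (forall u v, fbar (\pi_(quot_lmod K) u) (\pi_(quot_lmod K) v) = f u v) ->
  forall a, (forall b, fbar a b = 0) -> a = 0.
Proof.
move=> kerK fbarE a a0; have ra : repr a \in K.
  by apply: kerK => v; rewrite -fbarE reprK.
(* The zero class is rewritten as the class of the zero vector. *)
rewrite -[a]reprK -[RHS](scale0r (\pi_(quot_lmod K) 0)) -pi_quot_lmodZ scale0r.
by apply/eqP; rewrite eq_quot_lmod subr0.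
Qed.

Theorem proposition6p23 (R : realType) (n : nat) (G : lieGroupType R n)
    (m : riemannian_metric G) (m_inv : right_invariant m)
    (s : Esph G -> preEsph G) (sK : cancel s \pi_(Esph G)) :
  exists gbar : forall p : Esph G, {biscalar (sph_quot m (s p))},
    (forall (p : Esph G) (w w' : sph_tangent (s p)),
       gbar p (\pi_(sph_quot m (s p)) w) (\pi_(sph_quot m (s p)) w')
         = bary m w w') /\
    (forall (p : Esph G) (a : sph_quot m (s p)),
       (forall b : sph_quot m (s p), gbar p a b = 0) -> a = 0).
Proof.
have descent (q : preEsph G) : exists fbar : {biscalar (sph_quot m q)},
    forall w w', fbar (\pi_(sph_quot m q) w) (\pi_(sph_quot m q) w')
      = bary m w w'.
  have kerl (w w' : sph_tangent q) : w \in bary_ker m q -> bary m w w' = 0.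
    by rewrite unfold_in => /asboolP.
  apply: bilinear_form_descends => w w'; first exact: kerl.
  by move=> ?; rewrite /= bary_sym kerl.
exists (fun p => projT1 (cid (descent (s p)))); split=> [p w w'|p].
  exact: projT2 (cid (descent (s p))) w w'.
apply: descended_form_nondegenerate (projT2 (cid (descent (s p)))) => w w0.
by rewrite unfold_in; apply/asboolP.
Qed.
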